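(* 1) Let $\tau_{l(m_1),r(m_2)}$ and $\tau_{l(m_3),r(m_4)}$ be class transpositions of $\mathbb{Z}$ (equal-residue class transpositions), and assume that $\frac{m_1}{m_2}\neq\frac{m_3}{m_4}$. Then $\mathrm{ord}(\tau_{l(m_1),r(m_2)}\cdot\tau_{l(m_3),r(m_4)})=\infty$. 2) Let $\tau_{r_1(m),r_2(n)}$ and $\tau_{r_3(m),r_4(n)}$ be class transpositions of $\mathbb{Z}$ (equal-modulus class transpositions), and assume that $r_1\leqslant r_4$ and $r_3\leqslant r_2$. Then $\mathrm{ord}(\tau_{r_1(m),r_2(n)}\cdot\tau_{r_3(m),r_4(n)})\in\{1,2,3,6,\infty\}$.
   Context: For a natural number $m>1$ and an integer $r$ with $0\le r<m$, the residue class is $r(m)=r+m\mathbb{Z}=\{r+km \mid k\in\mathbb{Z}\}$. If $r_1(m_1)\cap r_2(m_2)=\emptyset$, the class transposition $\tau_{r_1(m_1),r_2(m_2)}$ is the permutation of $\mathbb{Z}$ which interchanges $r_1+km_1$ and $r_2+km_2$ for each integer $k$ and fixes all other integers. Thus saying that $\tau_{r_1(m_1),r_2(m_2)}$ is a class transposition includes the conditions $m_i>1$, $0\le r_i<m_i$ and $r_1(m_1)\cap r_2(m_2)=\emptyset$. The order $\mathrm{ord}(g)$ of a permutation $g\in\mathrm{Sym}(\mathbb{Z})$ is its order as a group element ($\infty$ if no positive power of $g$ is the identity); products are taken in $\mathrm{Sym}(\mathbb{Z})$. *)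

(* Defs.v *)
From HB Require Import structures.
From mathcomp Require Import all_boot all_order all_algebra all_fingroup.
From mathcomp Require Import boolp classical_sets.
Set Implicit Arguments.
Unset Strict Implicit.
Unset Printing Implicit Defensive.
Import GRing.Theory Num.Theory.

(* [{perm T}] exists only for finite [T]; [Sym T] is the symmetric group of an
   arbitrary type.  The inverse is stored so that it need not be chosen. *)
Record Sym (T : Type) := MkSym {
  sym_fun :> T -> T;
  sym_inv : T -> T;
  sym_funK : cancel sym_fun sym_inv;
  sym_invK : cancel sym_inv sym_fun }.

Lemma symP (T : Type) (s t : Sym T) : s =1 t -> s = t.
Proof.
case: s t => [f f' fK f'K] [g g' gK g'K] /= /funext eq_fg.
rewrite {}eq_fg in fK f'K *.
have eq_fg' : f' = g' by apply/funext => x; rewrite -{1}(g'K x) fK.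
rewrite {}eq_fg' in fK f'K *.
by congr MkSym; apply: Prop_irrelevance.
Qed.

Section SymGroup.
Variable T : Type.
Implicit Types s t u : Sym T.

Definition sym_one : Sym T := @MkSym T id id (frefl id) (frefl id).
Definition sym_V s : Sym T := MkSym (@sym_invK T s) (@sym_funK T s).
Definition sym_mul s t : Sym T :=
  MkSym (can_comp (@sym_funK T s) (@sym_funK T t))
        (can_comp (@sym_invK T t) (@sym_invK T s)).

Lemma sym_mulA : associative sym_mul.
Proof. by move=> s t u; apply: symP. Qed.
Lemma sym_mul1 : left_id sym_one sym_mul.
Proof. by move=> s; apply: symP. Qed.
Lemma sym_mulr1 : right_id sym_one sym_mul.
Proof. by move=> s; apply: symP. Qed.
Lemma sym_mulV : left_inverse sym_one sym_V sym_mul.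
Proof. by move=> s; apply: symP => x /=; rewrite sym_funK. Qed.
Lemma sym_mulrV : right_inverse sym_one sym_V sym_mul.
Proof. by move=> s; apply: symP => x /=; rewrite sym_invK. Qed.

HB.instance Definition _ := gen_eqMixin (Sym T).
HB.instance Definition _ := gen_choiceMixin (Sym T).
HB.instance Definition _ :=
  isGroup.Build (Sym T) sym_mulA sym_mul1 sym_mulr1 sym_mulV sym_mulrV.

End SymGroup.

Local Open Scope group_scope.

(* The right factor acts first; the order of a product of two elements does
   not depend on this choice, as s t and t s are conjugate. *)
Lemma symM (T : Type) (s t : Sym T) x : (s * t) x = s (t x).
Proof. by []. Qed.

Lemma symX (T : Type) (s : Sym T) n x : (s ^+ n) x = iter n s x.
Proof. by elim: n => [|n IHn] //=; rewrite expgS symM IHn. Qed.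

(* [None] stands for infinite order. *)
Definition ord (G : groupType) (g : G) : option nat :=
  match pselect (exists n, (0 < n)%N && (g ^+ n == 1)) with
  | left ex_n => Some (ex_minn ex_n)
  | right _ => None
  end.

Local Close Scope group_scope.
Local Open Scope ring_scope.
Local Open Scope classical_set_scope.

Definition residue_class (r : int) (m : nat) : set int :=
  [set x | exists k : int, x = r + k * m%:Z].

Record is_ct (r1 : int) (m1 : nat) (r2 : int) (m2 : nat) : Prop := IsCT {
  ct_m1 : (1 < m1)%N;
  ct_m2 : (1 < m2)%N;
  ct_r1 : 0 <= r1 < m1%:Z;
  ct_r2 : 0 <= r2 < m2%:Z;
  ct_disj : residue_class r1 m1 `&` residue_class r2 m2 = set0 }.

(* The defining properties of the transposition, valid only for disjoint
   classes with positive moduli, are [ct_fun1], [ct_fun2] and [ct_fun_fix]. *)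
Definition ct_fun (r1 : int) (m1 : nat) (r2 : int) (m2 : nat) (x : int) : int :=
  if (m1 %| x - r1)%Z then r2 + ((x - r1) %/ m1)%Z * m2%:Z
  else if (m2 %| x - r2)%Z then r1 + ((x - r2) %/ m2)%Z * m1%:Z
  else x.

Lemma residue_classE r m x : residue_class r m x <-> (m %| x - r)%Z.
Proof.
split=> [[k ->]|/dvdzP[k xr]]; first by rewrite addrC addKr dvdz_mull.
by exists k; rewrite -xr addrC subrK.
Qed.

Section ClassTransposition.
Variables (r1 : int) (m1 : nat) (r2 : int) (m2 : nat).
Hypothesis ct : is_ct r1 m1 r2 m2.

Lemma ct_fun1 k : ct_fun r1 m1 r2 m2 (r1 + k * m1%:Z) = r2 + k * m2%:Z.
Proof.
have m1_neq0 : m1%:Z != 0 by case: ct; case: (m1).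
by rewrite /ct_fun addrAC subrr add0r dvdz_mull ?mulzK.
Qed.

Lemma ct_fun2 k : ct_fun r1 m1 r2 m2 (r2 + k * m2%:Z) = r1 + k * m1%:Z.
Proof.
have m2_neq0 : m2%:Z != 0 by case: ct => _; case: (m2).
rewrite /ct_fun; case: ifPn => [/residue_classE in1|_].
  have : (residue_class r1 m1 `&` residue_class r2 m2) (r2 + k * m2%:Z).
    by split=> //; exists k.
  by rewrite (ct_disj ct).
by rewrite addrAC subrr add0r dvdz_mull ?mulzK.
Qed.

Lemma ct_fun_fix x : ~ residue_class r1 m1 x -> ~ residue_class r2 m2 x ->
  ct_fun r1 m1 r2 m2 x = x.
Proof.
by move=> /residue_classE/negP/negPf in1 /residue_classE/negP/negPf in2;
   rewrite /ct_fun in1 in2.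
Qed.

Lemma ct_funK : involutive (ct_fun r1 m1 r2 m2).
Proof.
move=> x.
case: (pselect (residue_class r1 m1 x)) => [[k ->]|out1].
  by rewrite ct_fun1 ct_fun2.
case: (pselect (residue_class r2 m2 x)) => [[k ->]|out2].
  by rewrite ct_fun2 ct_fun1.
by rewrite !ct_fun_fix.
Qed.

Definition tau : Sym int := MkSym ct_funK ct_funK.

End ClassTransposition.

(* Main.v *)
(** Write s and t for the two transpositions; t acts first in s * t.

    Part 1: s * t maps l + m2 m3 z to l + m1 m4 z, so its N-th power maps
    l + (m2 m3)^N to l + (m1 m4)^N, and these differ for N > 0.

    Part 2: the classes r1(m), r3(m) are equal or disjoint, and so are r2(n),
    r4(n).  If r3(m) misses r2(n) or r1(m) misses r4(n), the orbits of <s, t>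
    are paths with at most three vertices (unless s = t), so (s * t)^6 = 1.
    If both intersections are nonempty and m = n, then s = t.  If both are
    nonempty and m != n, put m' = m / gcd(m, n) and n' = n / gcd(m, n).  Each
    of the half steps r3 + k m -> r4 + k n = r1 + j m (by t) and
    r1 + j m -> r2 + j n = r3 + k' m (by s) turns a progression of parameters
    of difference m' A into one of difference n' A.  Hence (s * t)^N maps
    some progression of difference m'^(2N) m onto one of difference
    n'^(2N) m, and cannot be the identity. *)
Require Import Defs.
From mathcomp Require Import all_boot all_order all_algebra all_fingroup.
From mathcomp Require Import boolp classical_sets.
From mathcomp Require Import ring.
Set Implicit Arguments.
Unset Strict Implicit.
Unset Printing Implicit Defensive.
Import GRing.Theory Num.Theory.
Local Open Scope ring_scope.

Section Order.
Variable G : groupType.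
Implicit Type g : G.

Lemma ord_None g : (forall n, (0 < n)%N -> (g ^+ n)%g <> 1%g) -> ord g = None.
Proof.
move=> g_neq1; rewrite /ord; case: pselect => // ex_n.
by have [n /andP[n_gt0 /eqP gn1]] := ex_n; case: (g_neq1 n).
Qed.

Lemma ord_dvd g n : (0 < n)%N -> (g ^+ n)%g = 1%g ->
  exists2 k, ord g = Some k & (k %| n)%N.
Proof.
move=> n_gt0 gn1; rewrite /ord; case: pselect => [ex_n|[]]; last first.
  by exists n; rewrite n_gt0 gn1 eqxx.
case: ex_minnP => k /andP[k_gt0 /eqP gk1] min_k; exists k => //.
rewrite /dvdn eqn0Ngt; apply/negP => r_gt0.
suff gr1 : (g ^+ (n %% k) == 1)%g.
  have := min_k (n %% k)%N.
  by rewrite r_gt0 gr1 leqNgt ltn_mod k_gt0 => /(_ isT).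
apply/eqP; move: gn1.
by rewrite {1}(divn_eq n k) expgD mulnC expgM gk1 expg1n mul1g => ->.
Qed.

Lemma ord_expg6 g : (g ^+ 6)%g = 1%g ->
  ord g \in [:: Some 1; Some 2; Some 3; Some 6; None]%N.
Proof.
move=> /ord_dvd[] // k -> k_dvd6.
by case: k k_dvd6 (dvdn_leq (isT : 0 < 6)%N k_dvd6) => [|[|[|[|[|[|[|k]]]]]]].
Qed.

End Order.

(** In the second alternative, a point moved by both [s] and [t] is the middle of a path of three
    vertices, so the cycles of [s * t] have length 1, 2 or 3. *)
Lemma sym_mul_involutions6 (T : Type) (s t : Defs.Sym T) :
  involutive s -> involutive t ->
  (forall x, s x = t x) \/
  (forall x, [\/ s x = x, t x = x | t (s x) = s x /\ s (t x) = t x]) ->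
  ((s * t) ^+ 6)%g = 1%g.
Proof.
move=> sK tK short; apply: symP => x; rewrite symX /=.
case: short => [st|short]; first by rewrite !st !tK.
have [sx|tx|[tsx stx]] := short x.
- have [sy|ty|[tsy sty]] := short (t x).
  + by rewrite !(sy, tK, sx).
  + by move/(can_inj tK): ty => tx; rewrite !(tx, sx).
  + by rewrite !(tsy, sK, tK, sx).
- have [sy|ty|[tsy sty]] := short (s x).
  + by move/(can_inj sK): sy => sx; rewrite !(tx, sx).
  + by rewrite !(tx, ty, sK).
  + by rewrite !(tx, sty, sK, tK).
- by rewrite !(tsx, stx, sK, tK).
Qed.

Section Moves.
Variables (r1 r2 : int) (m n : nat) (ct : is_ct r1 m r2 n).

Lemma tau_invol : involutive (tau ct).
Proof. exact: ct_funK ct. Qed.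

Lemma tau_moved x : [\/ tau ct x = x,
  residue_class r1 m x /\ residue_class r2 n (tau ct x) |
  residue_class r2 n x /\ residue_class r1 m (tau ct x)].
Proof.
have [[k ->]|out1] := pselect (residue_class r1 m x).
  by apply: Or32; split; [exists k | rewrite /= ct_fun1 //; exists k].
have [[k ->]|out2] := pselect (residue_class r2 n x).
  by apply: Or33; split; [exists k | rewrite /= ct_fun2 //; exists k].
by apply: Or31; rewrite /= ct_fun_fix.
Qed.

Lemma tau_fix x : ~ residue_class r1 m x -> ~ residue_class r2 n x ->
  tau ct x = x.
Proof. exact: ct_fun_fix. Qed.

Lemma ct_disjoint x : residue_class r1 m x -> residue_class r2 n x -> False.
Proof.
move=> in1 in2; have : (residue_class r1 m `&` residue_class r2 n)%classic x.
  by split.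
by rewrite (ct_disj ct).
Qed.

End Moves.

Lemma residue_class_inj (r r' : int) (m : nat) x :
  0 <= r < m%:Z -> 0 <= r' < m%:Z ->
  residue_class r m x -> residue_class r' m x -> r = r'.
Proof.
move=> rm r'm [k ->] [k' /(congr1 (fun y => (y %% m)%Z))].
by rewrite ![_ + _ * _]addrC !modzMDl !modz_small.
Qed.

(** A point moved by both lies in r1(m) = r3(m), in r2(n) = r4(n), or in both r1(m) and r4(n). In
    each case the class holding its image under one transposition misses both classes of the
    other. *)
Lemma short_orbits (r1 r2 r3 r4 : int) (m n : nat)
    (ct12 : is_ct r1 m r2 n) (ct34 : is_ct r3 m r4 n)
    (s := tau ct12) (t := tau ct34) :
  (r1, r2) <> (r3, r4) ->
  (forall x, residue_class r3 m x -> residue_class r2 n x -> False) ->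
  forall x, [\/ s x = x, t x = x | t (s x) = s x /\ s (t x) = t x].
Proof.
move=> neq disj32 x.
have disj12 := ct_disjoint ct12; have disj34 := ct_disjoint ct34.
have eq13 y := @residue_class_inj r1 r3 m y (ct_r1 ct12) (ct_r1 ct34).
have eq24 y := @residue_class_inj r2 r4 n y (ct_r2 ct12) (ct_r2 ct34).
have [|[x1 sx2]|[x2 sx1]] := tau_moved ct12 x; first by constructor 1.
  have [|[x3 tx4]|[x4 tx3]] := tau_moved ct34 x; first by constructor 2.
  - have eq_13 := eq13 _ x1 x3; subst r3.
    have disj24 y : residue_class r2 n y -> residue_class r4 n y -> False.
      by move=> y2 y4; apply: neq; rewrite (eq24 _ y2 y4).
    constructor 3; split; apply: tau_fix.
    + by move=> sx3; apply: disj32 sx3 sx2.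
    + by move=> sx4; apply: disj24 sx2 sx4.
    + by move=> tx1; apply: disj34 tx1 tx4.
    + by move=> tx2; apply: disj24 tx2 tx4.
  - constructor 3; split; apply: tau_fix.
    + by move=> sx3; apply: disj32 sx3 sx2.
    + by move=> sx4; apply: disj12 x1 _; rewrite (eq24 _ sx2 sx4).
    + by move=> tx1; apply: disj34 _ x4; rewrite -(eq13 _ tx1 tx3).
    + by move=> tx2; apply: disj32 tx3 tx2.
have [|[x3 tx4]|[x4 tx3]] := tau_moved ct34 x; first by constructor 2.
  by case: (disj32 x).
have eq_24 := eq24 _ x2 x4; subst r4.
have disj13 y : residue_class r1 m y -> residue_class r3 m y -> False.
  by move=> y1 y3; apply: neq; rewrite (eq13 _ y1 y3).
constructor 3; split; apply: tau_fix.
- by move=> sx3; apply: disj13 sx1 sx3.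
- by move=> sx2; apply: disj12 sx1 sx2.
- by move=> tx1; apply: disj13 tx1 tx3.
- by move=> tx2; apply: disj32 tx3 tx2.
Qed.

(** As [A] is invertible modulo [m], the [t] with [c + A * t] congruent to [k0] modulo [m] form one
    class modulo [m], that of [t0]. *)
Lemma half_step (m : nat) (A c k0 : int) : coprimez A m ->
  exists t0 e, forall s, c + A * (t0 + m%:Z * s) = k0 + m%:Z * (e + A * s).
Proof.
case/coprimezP=> -[u v] /= uv.
(* The Bezout identity [u * A + v * m = 1], scaled by [k0 - c]. *)
exists (u * (k0 - c)), (- v * (k0 - c)) => s.
have uA : u * A = 1 - v * m%:Z by rewrite -uv addrK.
transitivity (c + (k0 - c) * (u * A) + m%:Z * A * s); first by ring.
by rewrite uA; ring.
Qed.

Lemma progression_map (r1 r2 r3 r4 : int) (m n p q : nat)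
    (ct12 : is_ct r1 m r2 n) (ct34 : is_ct r3 m r4 n) (x y : int) :
  coprime q p -> (p * n = q * m)%N ->
  residue_class r1 m x -> residue_class r4 n x ->
  residue_class r3 m y -> residue_class r2 n y ->
  forall N, exists k k', forall z,
    ((tau ct12 * tau ct34) ^+ N)%g (r3 + (k + p%:Z ^+ (2 * N) * z) * m%:Z)
      = r3 + (k' + q%:Z ^+ (2 * N) * z) * m%:Z.
Proof.
move=> co_qp /(congr1 Posz); rewrite !PoszM => pnqm.
(* Since [p * n = q * m], the point of r4(n) with parameter [k0 + p * i] is the point of r1(m) with
   parameter [j0 + q * i], with [x] at [i = 0]. Likewise [j1 + p * i] in r2(n) is [k1 + q * i] in
   r3(m), starting at [y]. *)
move=> [j0 ->] [k0 x4] [k1 ->] [j1 y2]; elim=> [|N [k [k' IHN]]].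
  by exists 0, 0 => z; rewrite muln0 !expr0.
have co_Xp i : coprimez (q%:Z ^+ i) p by apply: coprimezXl.
(* [t0] selects the points of the image progression that the second factor sends into r1(m); among
   these, [u0] selects those that the first factor then sends into r3(m). The first selection has
   already contributed one factor [q] to the difference. *)
have [t0 [e Dt]] := half_step k' k0 (co_Xp (2 * N)%N).
have [u0 [f Du]] := half_step (j0 + q%:Z * e) j1 (co_Xp (2 * N).+1).
exists (k + p%:Z ^+ (2 * N) * (t0 + p%:Z * u0)), (k1 + q%:Z * f) => z.
transitivity (tau ct12 (tau ct34
  (((tau ct12 * tau ct34) ^+ N)%g (r3 + (k + p%:Z ^+ (2 * N) *
     (t0 + p%:Z * (u0 + p%:Z * z))) * m%:Z)))).
  rewrite !symX /=; congr (ct_fun _ _ _ _ (ct_fun _ _ _ _ (iter _ _ _))).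
  by rewrite mulnS !exprS; ring.
rewrite IHN Dt /= ct_fun1 //.
have -> : r4 + (k0 + p%:Z * (e + q%:Z ^+ (2 * N) * (u0 + p%:Z * z))) * n%:Z
  = r1 + (j0 + q%:Z * e + q%:Z ^+ (2 * N).+1 * (u0 + p%:Z * z)) * m%:Z.
  by rewrite mulrDl addrA -x4 mulrAC pnqm exprS; ring.
rewrite ct_fun1 // Du.
have -> : r2 + (j1 + p%:Z * (f + q%:Z ^+ (2 * N).+1 * z)) * n%:Z
  = r3 + (k1 + q%:Z * f + q%:Z ^+ (2 * N.+1) * z) * m%:Z.
  by rewrite mulrDl addrA -y2 mulrAC pnqm mulnS !exprS; ring.
by [].
Qed.

Lemma tau_eq_swap (r1 r2 : int) (m : nat)
    (ct12 : is_ct r1 m r2 m) (ct21 : is_ct r2 m r1 m) x :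
  tau ct12 x = tau ct21 x.
Proof.
have [[k ->]|out1] := pselect (residue_class r1 m x).
  by rewrite /= ct_fun1 // ct_fun2.
have [[k ->]|out2] := pselect (residue_class r2 m x).
  by rewrite /= ct_fun2 // ct_fun1.
by rewrite !tau_fix.
Qed.

Lemma ord_equal_modulus (r1 r2 r3 r4 : int) (m n : nat)
    (ct12 : is_ct r1 m r2 n) (ct34 : is_ct r3 m r4 n) :
  ord (tau ct12 * tau ct34)%g = None \/ ((tau ct12 * tau ct34) ^+ 6)%g = 1%g.
Proof.
have sK := tau_invol ct12; have tK := tau_invol ct34.
have [[e13 e24]|neq] := pselect ((r1, r2) = (r3, r4)).
  right; apply: sym_mul_involutions6 => //; left=> x.
  (* The two transpositions now differ only in their proofs of [is_ct]. *)
  by subst r3 r4; congr (tau _ x); apply: Prop_irrelevance.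
have [[y [y3 y2]]|no_y] :=
    pselect (exists y, residue_class r3 m y /\ residue_class r2 n y); last first.
  right; apply: sym_mul_involutions6 => //; right.
  by apply: short_orbits => // y y3 y2; apply: no_y; exists y.
have [[x [x1 x4]]|no_x] :=
    pselect (exists x, residue_class r1 m x /\ residue_class r4 n x); last first.
  right; apply: sym_mul_involutions6 => //; right=> x.
  (* The situation is symmetric under exchanging the two transpositions. *)
  have neq' : (r3, r4) <> (r1, r2) by move/esym.
  have disj14 y1 : residue_class r1 m y1 -> residue_class r4 n y1 -> False.
    by move=> in1 in4; apply: no_x; exists y1.
  by have [tx|sx|[stx tsx]] := short_orbits ct34 ct12 neq' disj14 x;
    [constructor 2 | constructor 1 | constructor 3].
have [eq_mn|neq_mn] := eqVneq m n.
  subst n; right; apply: sym_mul_involutions6 => //; left=> z.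
  (* With a single modulus, classes that meet coincide, so the second transposition is the first
     with its classes swapped. *)
  have e14 := residue_class_inj (ct_r1 ct12) (ct_r2 ct34) x1 x4.
  have e32 := residue_class_inj (ct_r1 ct34) (ct_r2 ct12) y3 y2.
  by subst r4 r3; apply: tau_eq_swap.
left; apply: ord_None => N N_gt0 sN1.
have m_gt0 : (0 < m)%N := ltnW (ct_m1 ct12).
have d_gt0 : (0 < gcdn m n)%N by rewrite gcdn_gt0 m_gt0.
set p := (m %/ gcdn m n)%N; set q := (n %/ gcdn m n)%N.
have Dm : m = (p * gcdn m n)%N by rewrite divnK ?dvdn_gcdl.
have Dn : n = (q * gcdn m n)%N by rewrite divnK ?dvdn_gcdr.
have co_qp : coprime q p.
  by rewrite /coprime gcdnC -(eqn_pmul2r d_gt0) mul1n muln_gcdl -Dm -Dn.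
have pnqm : (p * n = q * m)%N by rewrite {1}Dn {2}Dm mulnCA.
have [k [k' prog]] := progression_map ct12 ct34 co_qp pnqm x1 x4 y3 y2 N.
have m_neq0 : m%:Z != 0 by rewrite eqz_nat -lt0n.
have prog_id z : k + p%:Z ^+ (2 * N) * z = k' + q%:Z ^+ (2 * N) * z.
  by have := prog z; rewrite sN1 /= => /addrI /(mulIf m_neq0).
(* Comparing [z = 0] with [z = 1] shows that the two progressions have the same difference. *)
have /eqP : p%:Z ^+ (2 * N) = q%:Z ^+ (2 * N).
  have := prog_id 1; have := prog_id 0; rewrite !mulr0 !addr0 !mulr1 => ->.
  by move/addrI.
rewrite eqrXn2 ?muln_gt0 // => /eqP[pq].
by case/negP: neq_mn; rewrite Dm {2}Dn pq.
Qed.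

Lemma ord_equal_residue (l r : int) (m1 m2 m3 m4 : nat)
    (ct12 : is_ct l m1 r m2) (ct34 : is_ct l m3 r m4) :
  (m2 * m3)%N <> (m1 * m4)%N -> ord (tau ct12 * tau ct34)%g = None.
Proof.
move=> neq; apply: ord_None => N N_gt0 sN1.
have sN : forall y, ((tau ct12 * tau ct34) ^+ N)%g
    (l + (m2 * m3)%N%:Z ^+ N * y) = l + (m1 * m4)%N%:Z ^+ N * y.
  rewrite {sN1 N_gt0} => y; rewrite symX; elim: N y => [|N IHN] y /=.
    by rewrite !expr0.
  rewrite exprSr -mulrA IHN /=.
  (* The factor [m2] stays in the parameter, so that the image in r(m4) also lies in r(m2) and is
     sent back to l(m1). *)
  have -> : l + (m1 * m4)%N%:Z ^+ N * ((m2 * m3)%N%:Z * y)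
    = l + ((m1 * m4)%N%:Z ^+ N * y * m2%:Z) * m3%:Z by rewrite PoszM; ring.
  by rewrite ct_fun1 // [_ * m4%:Z]mulrAC ct_fun2 // exprSr !PoszM; ring.
have := sN 1; rewrite sN1 /= !mulr1 => /addrI /eqP.
by rewrite eqrXn2 // => /eqP[].
Qed.

Theorem theorem1p2 :
  (forall (l r : int) (m1 m2 m3 m4 : nat)
          (ct12 : is_ct l m1 r m2) (ct34 : is_ct l m3 r m4),
     (m1%:Q / m2%:Q <> m3%:Q / m4%:Q) ->
     ord (tau ct12 * tau ct34)%g = None)
  /\
  (forall (r1 r2 r3 r4 : int) (m n : nat)
          (ct12 : is_ct r1 m r2 n) (ct34 : is_ct r3 m r4 n),
     r1 <= r4 -> r3 <= r2 ->
     ord (tau ct12 * tau ct34)%g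
       \in [:: Some 1%N; Some 2%N; Some 3%N; Some 6%N; None]).
Proof.
split=> [l r m1 m2 m3 m4 ct12 ct34 neq | r1 r2 r3 r4 m n ct12 ct34 _ _].
  apply: ord_equal_residue => eq_m; apply: neq; apply/eqP.
  have m2_neq0 : m2%:Q != 0 by rewrite intr_eq0 eqz_nat -lt0n ltnW ?(ct_m2 ct12).
  have m4_neq0 : m4%:Q != 0 by rewrite intr_eq0 eqz_nat -lt0n ltnW ?(ct_m2 ct34).
  by rewrite eqr_div // -!intrM -!PoszM -eq_m mulnC.
by have [->|/ord_expg6] := ord_equal_modulus ct12 ct34.
Qed.
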